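(* Let $(R,\mathfrak m)$ be a complete local domain. Suppose that there is an operation $\natural$ assigning to every pair $N\subseteq M$ of finitely generated $R$-modules a subset $N^\natural_M$ of $M$, such that the following hold for all finitely generated $R$-modules $N$, $M$, $W$ with $N\subseteq M$: (1) $N^\natural_M$ is a submodule of $M$ containing $N$. (2) $(N^\natural_M)^\natural_M=N^\natural_M$. (3) If $N\subseteq M\subseteq W$, then $N^\natural_W\subseteq M^\natural_W$. (4) If $f:M\to W$ is an $R$-module homomorphism, then $f(N^\natural_M)\subseteq f(N)^\natural_W$. (5) If $N^\natural_M=N$, then $0^\natural_{M/N}=0$. (6) $\mathfrak m^\natural_R=\mathfrak m$ and $0^\natural_R=0$. (7) If $x_1,\ldots,x_{k+1}$ is a partial system of parameters for $R$, $J=(x_1,\ldots,x_k)$, $f:M\to R/J$ is a surjective homomorphism, and $v\in M$ satisfies $f(v)=x_{k+1}+J$, then $(Rv)^\natural_M\cap\ker f\subseteq (Jv)^\natural_M$. Then there exists a balanced big Cohen-Macaulay $R$-module $B$.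
   Context: Local rings are Noetherian. A partial system of parameters is a sequence that forms part of a system of parameters of $R$. A balanced big Cohen-Macaulay module over $(R,\mathfrak m)$ is a (not necessarily finitely generated) $R$-module $B$ such that every system of parameters of $R$ is a regular sequence on $B$, i.e., whenever $x_1,\ldots,x_{k+1}$ is part of a system of parameters of $R$ and $b\in B$ satisfies $x_{k+1}b\in (x_1,\ldots,x_k)B$, then $b\in (x_1,\ldots,x_k)B$, and moreover $\mathfrak mB\neq B$. *)

(* Defs.v *)
From HB Require Import structures.
From mathcomp Require Import all_boot all_order all_algebra.
From mathcomp Require Import all_classical.

Set Implicit Arguments.
Unset Strict Implicit.
Unset Printing Implicit Defensive.

Import GRing.Theory.

Local Open Scope classical_set_scope.
Local Open Scope ring_scope.
Local Open Scope quotient_scope.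

(* Submodules and ideals are Prop-valued sets; the ideals of R are the
   submodules of the regular module R^o, the unit ideal included.  *)
Section Submodules.
Variables (R : comNzRingType) (M : lmodType R).

Definition submodule (N : set M) : Prop := submod_closed [in N].

Definition gen_submod (A : set M) : set M := smallest submodule A.

Lemma submodule_gen (A : set M) : submodule (gen_submod A).
Proof.
split=> [|a u v /set_mem uA /set_mem vA]; apply/mem_set => N NA.
  by have [[/set_mem]] := NA.
have [[_ Nlin] _] := NA.
by apply/set_mem/Nlin; apply/mem_set; [apply: uA|apply: vA].
Qed.

Definition finitely_generated (N : set M) : Prop :=
  exists s : seq M, gen_submod [set` s] = N.

(* The product I N, for an ideal I of R and a subset N of M. *)
Definition imul (I : set R) (N : set M) : set M :=
  gen_submod [set a *: v | a in I & v in N].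

End Submodules.

Definition fg_module (R : comNzRingType) (M : lmodType R) : Prop :=
  finitely_generated [set: M].

(* The additive group of the quotient is the one of ring_quotient; only the
   scalar action has to be added. *)
Section Quotient.
Variables (R : comNzRingType) (M : lmodType R) (N : set M).
Hypothesis submodN : submodule N.

Definition submod_pred : {pred M} := fun x => x \in N.

Fact submod_pred_closed : submod_closed submod_pred.
Proof. exact: submodN. Qed.

HB.instance Definition _ :=
  GRing.isSubmodClosed.Build R M submod_pred submod_pred_closed.

Definition quotm : Type := @Quotient.quot M submod_pred.

HB.instance Definition _ := GRing.Zmodule.on quotm.
HB.instance Definition _ := Quotient.on quotm.

Definition quotm_pi (x : M) : quotm := \pi_quotm x.

Definition quotm_scale (a : R) (x : quotm) : quotm := quotm_pi (a *: repr x).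

Lemma quotm_piE (x y : M) : (quotm_pi x = quotm_pi y) <-> N (x - y).
Proof.
split=> [/eqP|Nxy].
  by rewrite /quotm_pi -Quotient.idealrBE => /set_mem.
by apply/eqP; rewrite /quotm_pi -Quotient.idealrBE; apply/mem_set.
Qed.

Lemma quotm_piK (x : quotm) : quotm_pi (repr x) = x.
Proof. exact: reprK. Qed.

Lemma quotm_piD : {morph quotm_pi : x y / x + y}.
Proof. exact: Quotient.pi_add. Qed.

Lemma quotm_scaleE (a : R) (x : M) :
  quotm_scale a (quotm_pi x) = quotm_pi (a *: x).
Proof.
apply/quotm_piE; rewrite -scalerBr; apply/set_mem.
by rewrite (rpredZ a (_ : _ \in submod_pred))//; apply/mem_set/quotm_piE/quotm_piK.
Qed.

Fact quotm_scaleA a b x :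
  quotm_scale a (quotm_scale b x) = quotm_scale (a * b) x.
Proof. by rewrite -(quotm_piK x) !quotm_scaleE scalerA. Qed.

Fact quotm_scale1 : left_id 1 quotm_scale.
Proof. by move=> x; rewrite -(quotm_piK x) quotm_scaleE scale1r. Qed.

Fact quotm_scaleDr : right_distributive quotm_scale +%R.
Proof.
move=> a x y; rewrite -(quotm_piK x) -(quotm_piK y).
by rewrite -quotm_piD !quotm_scaleE -quotm_piD scalerDr.
Qed.

Fact quotm_scaleDl x : {morph quotm_scale^~ x : a b / a + b}.
Proof.
by move=> a b; rewrite -(quotm_piK x) !quotm_scaleE -quotm_piD scalerDl.
Qed.

HB.instance Definition _ := GRing.Zmodule_isLmodule.Build R quotm
  quotm_scaleA quotm_scale1 quotm_scaleDr quotm_scaleDl.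

Fact quotm_pi_linear : linear quotm_pi.
Proof. by move=> a x y; rewrite quotm_piD -quotm_scaleE. Qed.

HB.instance Definition _ :=
  GRing.isLinear.Build R M quotm *:%R quotm_pi quotm_pi_linear.

End Quotient.

Section LocalRings.
Variable R : comNzRingType.

Definition ideal_of (s : seq R) : set R := @gen_submod R R^o [set` s].

Lemma submodule_ideal_of (s : seq R) : @submodule R R^o (ideal_of s).
Proof. exact: submodule_gen. Qed.

Definition noetherian : Prop :=
  forall I : set R^o, submodule I -> finitely_generated I.

(* [idealr_closed] includes properness: 1 is not in the ideal. *)
Definition maximal_ideal (I : set R) : Prop :=
  idealr_closed [in I] /\
  forall J : set R, idealr_closed [in J] -> I `<=` J -> J = I.

Definition prime_ideal (P : set R) : Prop :=
  idealr_closed [in P] /\ prime_idealr_closed [in P].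

Definition local_ring (m : set R) : Prop :=
  [/\ noetherian, maximal_ideal m & forall I, maximal_ideal I -> I = m].

Definition ideal_exp (m : set R) (n : nat) : set R :=
  iter n (@imul R R^o m) setT.

(* The canonical map from R to the inverse limit of the R / m^n is
   injective and surjective. *)
Definition adically_complete (m : set R) : Prop :=
  \bigcap_n ideal_exp m n = [set 0] /\
  forall u : nat -> R, (forall n, ideal_exp m n (u n.+1 - u n)) ->
  exists l : R, forall n, ideal_exp m n (u n - l).

Definition prime_chain (n : nat) (P : nat -> set R) : Prop :=
  (forall i, (i <= n)%N -> prime_ideal (P i)) /\
  (forall i, (i < n)%N -> P i `<` P i.+1).

Definition krull_dim (d : nat) : Prop :=
  (exists P, prime_chain d P) /\
  forall n P, prime_chain n P -> (n <= d)%N.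

Definition radical (I : set R) : set R := [set a | exists n, I (a ^+ n)].

(* The elements of s lie in m since the radical contains the ideal. *)
Definition system_of_parameters (m : set R) (s : seq R) : Prop :=
  krull_dim (size s) /\ radical (ideal_of s) = m.

Definition partial_sop (m : set R) (s : seq R) : Prop :=
  exists t : seq R, system_of_parameters m (s ++ t).

Definition balanced_big_CM (m : set R) (B : lmodType R) : Prop :=
  (forall (s : seq R) (y : R), partial_sop m (rcons s y) ->
   forall b : B, imul (ideal_of s) [set: B] (y *: b) ->
                 imul (ideal_of s) [set: B] b) /\
  imul m [set: B] <> [set: B].

End LocalRings.

(* Main.v *)
Require Import Defs.
From HB Require Import structures.
From mathcomp Require Import all_boot all_order all_algebra.
From mathcomp Require Import all_classical.

Set Implicit Arguments.
Unset Strict Implicit.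
Unset Printing Implicit Defensive.

Import GRing.Theory.

Local Open Scope classical_set_scope.
Local Open Scope ring_scope.

(** As in Dietz's theorem, B is obtained from R by killing all obstructions to
    being Cohen-Macaulay through module modifications, and the closure bounds
    the process: if e : B is the image of 1, then a relation
    e (x) w = sum m_i (x) n_i in B (x) W must force w to lie in the closure of
    the span of the n_i in W.  This is inherited from B to the modification
    B' = (B + R^k) / R (u, x_1, ..., x_k), where y u lies in
    J B for J = (x_1, ..., x_k) and y is the next parameter: for the closure N' of
    N = span(n_i), the condition for B and the module W/N' x R/J, together with
    the colon axiom applied to the projection onto R/J, gives the condition
    for B' and W.  Applied to W = R and N = m, it says that e is not in m B.

    All modifications are performed inside one free module on symbols
    containing the new basis vectors of every possible modification, so that
    Zorn's lemma applies to sets of modifications. *)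

(** * Closure properties of submodules and generation *)

Section SubmoduleTheory.
Variables (R : comNzRingType) (M : lmodType R).
Implicit Types (A N : set M) (u v : M) (a : R).

Lemma submoduleI N :
  N 0 -> (forall a u v, N u -> N v -> N (a *: u + v)) -> submodule N.
Proof.
move=> N0 Nlin; split=> [|a u v /set_mem Nu /set_mem Nv]; apply/mem_set => //.
exact: Nlin.
Qed.

Lemma submodule0 N : submodule N -> N 0.
Proof. by case=> /set_mem. Qed.

Lemma submoduleL N a u v : submodule N -> N u -> N v -> N (a *: u + v).
Proof. by case=> _ + Nu Nv => /(_ a u v (mem_set Nu) (mem_set Nv))/set_mem. Qed.

Lemma submoduleD N u v : submodule N -> N u -> N v -> N (u + v).
Proof. by move=> sN Nu /(submoduleL 1 sN Nu); rewrite scale1r. Qed.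

Lemma submoduleZ N a u : submodule N -> N u -> N (a *: u).
Proof.
by move=> sN Nu; rewrite -[_ *: _]addr0; apply: submoduleL (submodule0 sN).
Qed.

Lemma submoduleN N u : submodule N -> N u -> N (- u).
Proof. by rewrite -scaleN1r; apply: submoduleZ. Qed.

Lemma submoduleB N u v : submodule N -> N u -> N v -> N (u - v).
Proof. by move=> sN Nu /(submoduleN sN); apply: submoduleD. Qed.

Lemma submodule_sum N (I : finType) (F : I -> M) :
  submodule N -> (forall i, N (F i)) -> N (\sum_i F i).
Proof.
move=> sN NF; apply: big_ind => //; first exact: submodule0.
by move=> u v; apply: submoduleD.
Qed.

Lemma submodule_set0 : submodule [set 0 : M].
Proof. by apply: submoduleI => // a u v -> ->; rewrite scaler0 addr0. Qed.

Lemma mem_gen_submod A u : A u -> gen_submod A u.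
Proof. exact: sub_gen_smallest. Qed.

Lemma gen_submod_sub A N : submodule N -> A `<=` N -> gen_submod A `<=` N.
Proof. exact: smallest_sub. Qed.

Lemma mem_imul (I : set R) N a v : I a -> N v -> imul I N (a *: v).
Proof. by move=> Ia Nv; apply: mem_gen_submod; exists a => //; exists v. Qed.

Lemma fg_moduleI (s : seq M) :
  (forall N, submodule N -> {in s, forall u, N u} -> N = setT) -> fg_module M.
Proof.
move=> sT; exists s; apply: sT => [|u us]; first exact: submodule_gen.
exact: mem_gen_submod.
Qed.

Lemma fg_module_sub : fg_module M ->
  exists s : seq M, forall N, submodule N -> {in s, forall u, N u} -> N = setT.
Proof.
case=> s sT; exists s => N sN Ns; apply/seteqP; split=> // u _.
by have : gen_submod [set` s] u by [rewrite sT]; apply: gen_submod_sub.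
Qed.

End SubmoduleTheory.

(** * Finite generation of images, quotients and products *)

Section FinitelyGenerated.
Variable R : comNzRingType.
Implicit Types M W : lmodType R.

Lemma linear_at0 M W (f : M -> W) : linear f -> f 0 = 0.
Proof. by move=> lf; have := lf (-1) 0 0; rewrite scaler0 addr0 scaleN1r addNr. Qed.

Lemma submodule_preimage M W (f : M -> W) (N : set W) :
  linear f -> submodule N -> submodule (f @^-1` N).
Proof.
move=> lf sN; apply: submoduleI => [|a u v Nu Nv] /=.
  by rewrite (linear_at0 lf); apply: submodule0.
by rewrite lf; apply: submoduleL.
Qed.

Lemma linear_pairl M W : linear (fun u : M => (u, 0 : W)).
Proof. by move=> a u v; apply/eqP; rewrite xpair_eqE/= scaler0 addr0 !eqxx. Qed.

Lemma linear_pairr M W : linear (fun w : W => (0 : M, w)).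
Proof. by move=> a u v; apply/eqP; rewrite xpair_eqE/= scaler0 addr0 !eqxx. Qed.

Lemma fg_module_surj M W (f : {linear M -> W}) :
  range f = setT -> fg_module M -> fg_module W.
Proof.
move=> fT /fg_module_sub[s sT]; apply: (@fg_moduleI _ _ (map f s)) => N sN Ns.
apply/seteqP; split=> // w _; have [u _ <-] : range f w by rewrite fT.
suff : (f @^-1` N) u by [].
by rewrite (sT _ (submodule_preimage (linearP f) sN))// => x xs; apply/Ns/map_f.
Qed.

Lemma range_quotm_pi M (N : set M) (sN : submodule N) :
  range (quotm_pi sN) = setT.
Proof.
by apply/seteqP; split=> // x _; exists (repr x) => //; apply: quotm_piK.
Qed.

Lemma fg_module_quotm M (N : set M) (sN : submodule N) :
  fg_module M -> fg_module (quotm sN).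
Proof. exact/(@fg_module_surj _ _ (quotm_pi sN))/range_quotm_pi. Qed.

Lemma fg_module_regular : fg_module R^o.
Proof.
apply: (@fg_moduleI _ _ [:: 1]) => N sN N1; apply/seteqP; split=> // a _.
by rewrite -[a]mulr1; apply: submoduleZ sN _; apply/N1/mem_head.
Qed.

Lemma fg_module_pair M W :
  fg_module M -> fg_module W -> fg_module (M * W)%type.
Proof.
move=> /fg_module_sub[s sT] /fg_module_sub[t tT].
apply: (@fg_moduleI _ _ ([seq (u, 0) | u <- s] ++ [seq (0, w) | w <- t])).
move=> N sN Nst; apply/seteqP; split=> // -[u w] _.
have Nl : [set u | N (u, 0)] = setT.
  apply: sT => [|x xs]; last by apply: Nst; rewrite mem_cat map_f.
  exact: submodule_preimage (@linear_pairl M W) sN.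
have Nr : [set w | N (0, w)] = setT.
  apply: tT => [|x xs]; last by apply: Nst; rewrite mem_cat map_f ?orbT.
  exact: submodule_preimage (@linear_pairr M W) sN.
have -> : (u, w) = (u, 0) + (0, w) :> (M * W)%type.
  by apply/eqP; rewrite xpair_eqE/= addr0 add0r !eqxx.
apply: submoduleD => //.
- by have : [set u | N (u, 0)] u by rewrite Nl.
- by have : [set w | N (0, w)] w by rewrite Nr.
Qed.

End FinitelyGenerated.

(** * Subquotients of a module *)

Section Subquotient.
Variables (R : comNzRingType) (M : lmodType R) (F : set M).

(* The proof of [submodule F] is a dummy argument, from which unification
   recovers the module structure of [submod]. *)
Definition submod_mem (_ : submodule F) : {pred M} := fun x => x \in F.

Hypothesis submodF : submodule F.

Fact submod_mem_closed : submod_closed (submod_mem submodF).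
Proof. exact: submodF. Qed.

HB.instance Definition _ :=
  GRing.isSubmodClosed.Build R M (submod_mem submodF) submod_mem_closed.

Definition submod : Type := {x : M | submod_mem submodF x}.

HB.instance Definition _ := SubChoice.on submod.
HB.instance Definition _ := [SubChoice_isSubLmodule of submod by <:].

End Subquotient.

(* [p] is only meaningful on [F], so that [B] plays the role of F / (F :&: K). *)
Lemma subquotient (R : comNzRingType) (M : lmodType R) (F K : set M) :
  submodule F -> submodule K ->
  exists (B : lmodType R) (p : M -> B),
    [/\ forall a x y, F x -> F y -> p (a *: x + y) = a *: p x + p y,
        forall b, exists2 x, F x & p x = b &
        forall x, F x -> (p x = 0 <-> K x)].
Proof.
move=> sF sK.
pose i : {linear submod sF -> M} := val.
have sK' : submodule (i @^-1` K) := submodule_preimage (linearP i) sK.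
(* Outside [F], [j] takes the default value 0. *)
pose j x : submod sF := insubd 0 x.
have iK x : F x -> i (j x) = x by move=> Fx; apply: insubdK; apply: mem_set.
exists (quotm sK'); exists (fun x => quotm_pi sK' (j x)).
split=> [a x y Fx Fy|b|x Fx].
- rewrite -linearP; congr quotm_pi; apply: val_inj.
  by rewrite -[LHS]/(i _) -[RHS]/(i _) linearP !iK//; apply: submoduleL.
- exists (i (repr b)); first exact/set_mem/(valP (repr b)).
  by rewrite -[RHS]quotm_piK /j /i valKd.
- by rewrite -(linear0 (quotm_pi sK')) quotm_piE subr0 -{2}(iK x Fx).
Qed.

(** * Modifications and their relation modules *)

Section Modifications.
Variable R : comNzRingType.

(* [Soln (s, u) l] is the l-th new basis vector of the modification that makes
   the combination [u] of symbols a combination of [s]. *)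
Inductive symbol : Type :=
| Root
| Soln of seq R * seq (R * symbol) & nat.

Definition modification : Type := (seq R * seq (R * symbol))%type.

Implicit Types (S : set modification) (t : modification) (W : lmodType R).

Definition delta (z x : symbol) : R := (`[< z = x >])%:R.

Definition eval (u : seq (R * symbol)) (x : symbol) : R :=
  \sum_(p <- u) p.1 * delta p.2 x.

Definition relator t (x : symbol) : R :=
  eval t.2 x - \sum_(l < size t.1) t.1`_l * delta (Soln t l) x.

(* The image of K (x) W in the functions to W, for K the relation module of S. *)
Definition relators S W : set (symbol -> W) :=
  gen_submod [set h | exists2 t, S t & exists w, h = fun x => relator t x *: w].

Definition symbols S : set symbol :=
  [set x | x = Root \/ exists t l, S t /\ x = Soln t l].

(** This makes the new basis vectors of a modification outside [S] independent of the relations of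
    [S]. Coefficients are tested instead of the list [t.2], whose entries may cancel. *)
Definition closed_modifications S : Prop :=
  forall t, S t -> forall x, eval t.2 x <> 0 -> symbols S x.

Lemma delta_eq z : delta z z = 1.
Proof. by rewrite /delta asboolT. Qed.

Lemma delta_neq z x : z <> x -> delta z x = 0.
Proof. by move=> zx; rewrite /delta asboolF. Qed.

Lemma eval_cat u v x : eval (u ++ v) x = eval u x + eval v x.
Proof. exact: big_cat. Qed.

Lemma eval_scale a u x :
  eval [seq (a * p.1, p.2) | p <- u] x = a * eval u x.
Proof.
by rewrite /eval big_map mulr_sumr; apply: eq_bigr => p _; rewrite mulrA.
Qed.

Lemma eval_symbol z : eval [:: (1, z)] = delta z.
Proof. by apply/funext => x; rewrite /eval big_seq1 mul1r. Qed.

Lemma relator_self t l : (l < size t.1)%N ->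
  relator t (Soln t l) = eval t.2 (Soln t l) - t.1`_l.
Proof.
move=> lt; rewrite /relator (bigD1 (Ordinal lt))//= delta_eq mulr1 big1 ?addr0//.
move=> i /eqP il; rewrite delta_neq ?mulr0// => -[] ei.
by apply/il/val_inj.
Qed.

Lemma relator_other t t' l : t <> t' ->
  relator t (Soln t' l) = eval t.2 (Soln t' l).
Proof.
move=> tt'; rewrite /relator big1 ?subr0// => i _.
by rewrite delta_neq ?mulr0// => -[].
Qed.

Lemma submodule_relators S W : submodule (@relators S W).
Proof. exact: submodule_gen. Qed.

Lemma relators_sub S (S' : set modification) W :
  S `<=` S' -> @relators S W `<=` @relators S' W.
Proof.
move=> SS'; apply: gen_submod_sub (submodule_relators _ _) _ => _ [t St [w ->]].
by apply: mem_gen_submod; exists t; [apply: SS'|exists w].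
Qed.

Lemma relators_comp S W (T : lmodType R) (f : W -> T) h :
  linear f -> relators S h -> relators S (f \o h).
Proof.
move=> lf; pose g (k : symbol -> W) := f \o k.
have lg : linear g by move=> a u v; apply/funext => x; apply: lf.
apply: (@gen_submod_sub _ _ _ (g @^-1` @relators S T)).
  exact: submodule_preimage lg (submodule_relators _ _).
move=> _ [t St [w ->]]; apply: mem_gen_submod; exists t => //.
exists (f w); apply/funext => x /=; have := lf (relator t x) w 0.
by rewrite (linear_at0 lf) !addr0.
Qed.

(** All multiples of [relator t] merge into one term because scalars can be moved into the vector
    [w]. *)
Lemma relatorsU1 S t W h : @relators (t |` S) W h ->
  exists h0 w, @relators S W h0 /\ h = fun x => h0 x + relator t x *: w.
Proof.
apply: (@gen_submod_sub _ _ _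
  [set h | exists h0 w, relators S h0 /\ h = fun x => h0 x + relator t x *: w]).
  apply: submoduleI => [|a _ _ [h1 [w1 [h1S ->]]] [h2 [w2 [h2S ->]]]].
    exists 0; exists 0; split; first exact: submodule0 (@submodule_relators _ _).
    by apply/funext => x; rewrite scaler0 addr0.
  exists (a *: h1 + h2); exists (a *: w1 + w2); split.
    exact: submoduleL (submodule_relators _ _) _ _.
  apply/funext => x; set r := relator t x.
  rewrite -[LHS]/(a *: (h1 x + r *: w1) + (h2 x + r *: w2)).
  rewrite -[RHS]/(a *: h1 x + h2 x + r *: (a *: w1 + w2)).
  by rewrite !scalerDr !scalerA [a * r]mulrC addrACA.
move=> _ [t' [->|St'] [w ->]].
  exists 0; exists w; split; first exact: submodule0 (@submodule_relators _ _).
  by apply/funext => x; rewrite add0r.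
exists (fun x => relator t' x *: w); exists 0; split.
  by apply: mem_gen_submod; exists t' => //; exists w.
by apply/funext => x; rewrite scaler0 addr0.
Qed.

(** In a relator of [S], [Soln t l] is neither one of the new basis vectors, as [t] is not in [S],
    nor in the support of the combination, by closedness. *)
Lemma relators_fresh S t l W h : closed_modifications S -> ~ S t ->
  @relators S W h -> h (Soln t l) = 0.
Proof.
move=> Scl St; apply: (@gen_submod_sub _ _ _ [set h | h (Soln t l) = 0]).
  apply: submoduleI => // a u v /= u0 v0.
  by rewrite -[LHS]/(a *: u _ + v _) u0 v0 scaler0 addr0.
move=> _ [t' St' [w ->]] /=; rewrite relator_other; last by move=> tt; subst t'.
have [->|/eqP /(Scl _ St')[//|[t'' [l' [St'' []]]]]] := eqVneq (eval t'.2 (Soln t l)) 0.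
  by rewrite scale0r.
by move=> tt; subst t''.
Qed.

(** A relation involves finitely many modifications, and finitely many members of a chain lie in a
    single one. *)
Lemma relators_bigcup (C : set (set modification)) W h :
  C !=set0 -> total_on C subset ->
  @relators (\bigcup_(S in C) S) W h -> exists2 S, C S & relators S h.
Proof.
move=> [S0 CS0] Ctot.
apply: (@gen_submod_sub _ _ _ [set h | exists2 S, C S & relators S h]).
  apply: submoduleI => [|a u v [S CS Su] [S' CS' Sv]].
    by exists S0 => //; apply: submodule0 (@submodule_relators _ _).
  have [SS|SS] := Ctot _ _ CS CS'.
    exists S' => //; apply: submoduleL (submodule_relators _ _) _ Sv.
    exact: relators_sub SS _ Su.
  exists S => //; apply: submoduleL (submodule_relators _ _) Su _.
  exact: relators_sub SS _ Sv.
move=> _ [t [S CS St] [w ->]]; exists S => //; apply: mem_gen_submod.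
by exists t => //; exists w.
Qed.

End Modifications.

(** * Control by the closure, and construction of B *)

Section ControlledModifications.
Variables (R : comNzRingType) (m : set R).
Variable nat_cl : forall M : lmodType R, set M -> set M.

Hypothesis nat_submodule : forall (M : lmodType R) (N : set M),
  fg_module M -> submodule N -> submodule (nat_cl N) /\ N `<=` nat_cl N.
Hypothesis nat_idem : forall (M : lmodType R) (N : set M),
  fg_module M -> submodule N -> nat_cl (nat_cl N) = nat_cl N.
Hypothesis nat_image :
  forall (M W : lmodType R) (N : set M) (f : {linear M -> W}),
  fg_module M -> fg_module W -> submodule N ->
  f @` nat_cl N `<=` nat_cl (f @` N).
Hypothesis nat_quot :
  forall (M : lmodType R) (N : set M) (sN : submodule N),
  fg_module M -> nat_cl N = N -> @nat_cl (quotm sN) [set 0] = [set 0].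
Hypothesis nat_max : @nat_cl R^o m = m.
Hypothesis nat_colon :
  forall (s : seq R) (x : R), partial_sop m (rcons s x) ->
  forall (M : lmodType R) (f : {linear M -> quotm (submodule_ideal_of s)})
         (v : M),
  fg_module M -> range f = setT -> f v = quotm_pi (submodule_ideal_of s) x ->
  nat_cl (gen_submod [set v]) `&` f @^-1` [set 0]
    `<=` nat_cl (imul (ideal_of s) [set v]).

(* The elements [h x], [x <> Root], play the role of the n_i of the header. *)
Definition controlled (S : set (modification R)) : Prop :=
  forall (W : lmodType R) (N : set W) (h : symbol R -> W),
  fg_module W -> submodule N -> relators S h ->
  (forall x, x <> @Root R -> N (h x)) -> nat_cl N (h (@Root R)).

Lemma controlled_set0 : controlled set0.
Proof.
move=> W N h Wfg sN hS _; have [sN1 _] := nat_submodule Wfg sN.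
suff -> : h = 0 by apply: submodule0 sN1.
apply: (gen_submod_sub (@submodule_set0 _ _) _ hS) => _ [t []].
Qed.

Lemma controlled_bigcup (C : set (set (modification R))) :
  C !=set0 -> total_on C subset -> (forall S, C S -> controlled S) ->
  controlled (\bigcup_(S in C) S).
Proof.
move=> C0 Ctot Cctrl W N h Wfg sN /(relators_bigcup C0 Ctot)[S CS hS].
exact: Cctrl CS _ _ _ _ _ hS.
Qed.

(** For u the combination [t.2] and J the ideal of [t.1], the conditions on [k] express that y u
    lies in J B for the module B defined by [S]: y u agrees modulo J with a relation. *)
Lemma controlled_setU1 S (t : modification R) y (k : symbol R -> R^o) :
  partial_sop m (rcons t.1 y) -> closed_modifications S -> ~ S t ->
  (forall x, eval t.2 x <> 0 -> symbols S x) ->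
  relators S k -> (forall x, ideal_of t.1 (y * eval t.2 x - k x)) ->
  controlled S -> controlled (t |` S).
Proof.
move=> ypar Scl St tS kS kE Sctrl W N h Wfg sN /relatorsU1[h0 [w [h0S hE]]] hN.
have [sN1 NN1] := nat_submodule Wfg sN.
pose q := quotm_pi sN1; pose j := quotm_pi (submodule_ideal_of t.1).
pose T : lmodType R := (quotm sN1 * quotm (submodule_ideal_of t.1))%type.
have Tfg : fg_module T.
  apply: fg_module_pair; apply: fg_module_quotm => //.
  exact: fg_module_regular.
(* The value of [h] at [Soln t l] is the negative of this element, since [h0] and the combination
   [t.2] both vanish there. *)
have Nw l : (l < size t.1)%N -> N (t.1`_l *: w).
  move=> lt; have /hN : Soln t l <> @Root R by [].
  rewrite hE (relators_fresh _ Scl St h0S) relator_self// add0r.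
  have [->|/eqP/tS[//|[t' [l' [St' []]]]]] := eqVneq (eval t.2 (Soln t l)) 0.
    by rewrite sub0r scaleNr => /(submoduleN sN); rewrite opprK.
  by move=> tt; subst t'.
(* The sign cancels the term of [w] that separates [q (h0 x)] from [q (h x)], giving [h'E]; the
   second component is the one the colon axiom asks for. *)
pose v : T := (- q w, j y).
pose h' x : T := (q (h0 x), j (k x)).
have h'S : relators S h'.
  have -> : h' = (fun x => (q (h0 x), 0)) + (fun x => (0, j (k x))) :> (_ -> T).
    apply/funext => x; apply/eqP.
    by rewrite -[eqbRHS]/((_, _) + (_, _)) xpair_eqE/= addr0 add0r !eqxx.
  apply: submoduleD (@submodule_relators _ _ _) _ _.
    apply: (@relators_comp _ _ _ T (fun w => (q w, 0)) _ _ h0S) => a u u'.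
    by rewrite /q linearP; apply: linear_pairl.
  apply: (@relators_comp _ _ _ T (fun a : R^o => (0, j a)) _ _ kS) => a u u'.
  by rewrite /j linearP; apply: linear_pairr.
have qE x : q (h0 x) = q (h x) - eval t.2 x *: q w.
  rewrite /q -linearZ -linearB; apply/quotm_piE/NN1; rewrite hE /relator.
  rewrite scalerBl -addrA addrAC subrr add0r opprD opprK addrA subrr add0r.
  rewrite scaler_suml; apply: submodule_sum => // l.
  by rewrite mulrC -scalerA; apply: submoduleZ sN _; apply: Nw.
have jE x : j (k x) = eval t.2 x *: j y.
  rewrite /j -linearZ; apply/esym/quotm_piE.
  by rewrite -[_ *: _]/(_ * _) mulrC; apply: kE.
have h'E x : h' x = (q (h x), 0) + eval t.2 x *: v.
  apply/eqP; rewrite [eqbLHS]/h' qE jE xpair_eqE/= add0r scalerN !eqxx//.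
have [sT1 vT1] := nat_submodule Tfg (submodule_gen [set v]).
have gv a : gen_submod [set v] (a *: v).
  by apply: submoduleZ (submodule_gen _) _; apply: mem_gen_submod.
(* Away from [Root], [h'] takes values in R v, so control of [S] applies to it. Subtracting a
   multiple of [v] from the value at [Root] then lands in the kernel of [snd]. *)
have natv : nat_cl (gen_submod [set v]) ((q (h (@Root R)), 0) : T).
  have -> : (q (h (@Root R)), 0) = h' (@Root R) - eval t.2 (@Root R) *: v :> T.
    by rewrite h'E addrK.
  apply: submoduleB sT1 _ _; last exact: vT1 (gv _).
  apply: Sctrl => //; first exact: submodule_gen.
  move=> x /hN/NN1 Nx; rewrite h'E.
  suff -> : q (h x) = 0 by rewrite -[(0, 0)]/(0 : T) add0r; apply: gv.
  by rewrite /q -(linear0 (quotm_pi sN1)); apply/quotm_piE; rewrite subr0.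
(* By [Nw], J w lies in [N], so the first projection kills J v. *)
have fstJ : fst @` imul (ideal_of t.1) [set v] = [set 0 : quotm sN1].
  apply/seteqP; split=> [_ [z zJ <-]|_ ->]; last first.
    by exists 0 => //; apply: submodule0 (submodule_gen _).
  apply: (@gen_submod_sub _ _ _ (fst @^-1` [set 0 : quotm sN1])) zJ.
    exact: submodule_preimage (linearP fst) (@submodule_set0 _ _).
  move=> _ [a aJ [_ -> <-]] /=.
  suff Na : N (a *: w).
    rewrite scalerN /q -linearZ -linearN -(linear0 (quotm_pi sN1)).
    by apply/quotm_piE/NN1; rewrite subr0; apply: submoduleN.
  apply: (@gen_submod_sub _ R^o _ [set a : R^o | N (a *: w)]) aJ.
    apply: (@submodule_preimage _ R^o _ (fun a : R^o => a *: w)) sN => b u u'.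
    by rewrite scalerDl scalerA.
  by move=> b /(nthP 0)[l lt <-]; apply: Nw.
have : ((fst : {linear T -> quotm sN1}) @`
    nat_cl (imul (ideal_of t.1) [set v])) (q (h (@Root R))).
  exists ((q (h (@Root R)), 0) : T) => //.
  apply: (nat_colon ypar (f := snd)) => //.
  apply/seteqP; split=> // z _; exists (0, z) => //.
(* Zero is closed in the quotient by [nat_cl N], as [nat_cl N] is closed by idempotence. *)
move=> /nat_image; rewrite fstJ nat_quot//; last exact: nat_idem.
move=> /(_ Tfg (fg_module_quotm _ Wfg) (submodule_gen _)) /=.
by rewrite /q -(linear0 (quotm_pi sN1)) => /quotm_piE; rewrite subr0.
Qed.

Lemma controlled_root S (k : symbol R -> R^o) :
  @submodule R R^o m -> controlled S -> relators S k ->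
  (forall x, x <> @Root R -> m (k x)) -> m (k (@Root R)).
Proof.
move=> sm Sctrl kS km; rewrite -nat_max.
exact: Sctrl (@fg_module_regular R) sm kS km.
Qed.

(** Zorn's lemma gives a maximal closed controlled set; by [controlled_setU1], any admissible
    modification missing from it could be added. *)
Lemma maximal_controlled : exists S : set (modification R),
  [/\ closed_modifications S, controlled S &
      forall t y (k : symbol R -> R^o), partial_sop m (rcons t.1 y) ->
        (forall x, eval t.2 x <> 0 -> symbols S x) -> relators S k ->
        (forall x, ideal_of t.1 (y * eval t.2 x - k x)) -> S t].
Proof.
pose P S := closed_modifications S /\ controlled S.
have [C CP Ctot|S [[Scl Sctrl] Smax]] := @Zorn_bigcup _ P.
  (* The empty chain is bounded by the empty set of modifications, which defines R itself. *)
  have [->|/set0P C0] := eqVneq C set0.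
    by rewrite bigcup_set0; split=> [t []|]; apply: controlled_set0.
  split; last by apply: controlled_bigcup => // S /CP[].
  move=> t [S CS St] x /((CP _ CS).1 t St)[->|[t' [l [St' ->]]]]; first by left.
  by right; exists t', l; split => //; exists S.
exists S; split=> // t y k ypar tS kS kE; apply: contrapT => St.
have SU : S `<` (t |` S).
  by split; [right|move=> /(_ t (or_introl erefl))].
apply: (Smax _ SU); split; last exact: controlled_setU1 kS kE Sctrl.
have sub x : symbols S x -> symbols (t |` S) x.
  by case=> [->|[t' [l [St' ->]]]]; [left|right; exists t', l; split; [right|]].
by move=> t' [->|St'] x xt; apply: sub; [apply: tS|apply: Scl xt].
Qed.

(** This is the free module on [symbols S]. The list [u] encodes finiteness of support and is the
    datum from which a modification is built. *)
Definition combinations (S : set (modification R)) : set (symbol R -> R^o) :=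
  [set f | (forall x, f x <> 0 -> symbols S x) /\ exists u, f = eval u].

Lemma submodule_combinations S : submodule (combinations S).
Proof.
apply: submoduleI => [|a f g [fS [u fu]] [gS [v gv]]].
  by split=> //; exists [::]; apply/funext => x; rewrite /eval big_nil.
split=> [x|].
  rewrite -[(_ + _) x]/(a * f x + g x) => ne0.
  have [f0|/eqP/fS//] := eqVneq (f x) 0.
  by apply: gS => g0; apply: ne0; rewrite f0 g0 mulr0 addr0.
exists ([seq (a * p.1, p.2) | p <- u] ++ v).
by apply/funext => x; rewrite eval_cat eval_scale fu gv.
Qed.

Lemma combinations_delta S z : symbols S z -> combinations S (delta z).
Proof.
move=> Sz; split; last by exists [:: (1, z)]; rewrite eval_symbol.
by move=> x; have [<-//|zx] := pselect (z = x); rewrite delta_neq.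
Qed.

Lemma controlled_bigCM :
  @submodule R R^o m -> ~ m 1 -> exists B : lmodType R, balanced_big_CM m B.
Proof.
move=> sm m1; have [S [Scl Sctrl Ssat]] := maximal_controlled.
pose F := combinations S.
have sF : submodule F := submodule_combinations S.
have sK : submodule (@relators R S R^o) := @submodule_relators R S R^o.
have [B [p [plin psurj pK]]] := subquotient sF sK.
have p0 : p 0 = 0 by apply/(pK _ (submodule0 sF)); apply: submodule0.
have pZ a f : F f -> p (a *: f) = a *: p f.
  by move=> Ff; have := plin a f 0 Ff (submodule0 sF); rewrite p0 !addr0.
have pB f g : F f -> F g -> p f = p g -> relators S (f - g).
  move=> Ff Fg fg; have FB : F (f - g) by apply: submoduleB.
  apply/(pK _ FB); rewrite addrC -scaleN1r plin// fg scaleN1r addNr//.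
(* An element of I B is represented by a combination with all coefficients in I. *)
have lift (I : set R) b : @submodule R R^o I -> imul I [set: B] b ->
    exists f, [/\ F f, p f = b & forall x, I (f x)].
  move=> sI; apply: (@gen_submod_sub _ _ _
    [set b | exists f, [/\ F f, p f = b & forall x, I (f x)]]).
    apply: submoduleI => [|a _ _ [f [Ff <- fI]] [g [Fg <- gI]]].
      exists 0; split=> [||x]; [exact: submodule0|exact: p0|].
      exact: submodule0 sI.
    exists (a *: f + g); split=> [||x]; [exact: submoduleL|exact: plin|].
    exact: submoduleL sI _ _.
  move=> _ [a Ia [b' _ <-]]; have [f Ff <-] := psurj b'.
  exists (a *: f); split=> [||x]; [exact: submoduleZ|exact: pZ|].
  rewrite -[(a *: f) x]/(a * f x) mulrC.
  exact: (@submoduleZ _ R^o _ _ _ sI Ia).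
have rootF : F (delta (@Root R)) by apply: combinations_delta; left.
exists B; split=> [s y ypar b yb|mB].
  have [f [fS [u fu]] fb] := psurj b.
  have Ff : F f by split=> //; exists u.
  have [g [Fg gb gs]] := lift _ _ (submodule_ideal_of s) yb.
  pose t : modification R := (s, u).
  (* Both [y *: f] and [g] represent y b, so their difference is a relation congruent to y f modulo
     the ideal of [s]; saturation of [S] applies. *)
  have St : S t.
    apply: (Ssat t y (y *: f - g)) => //=; first by rewrite -fu.
      by apply: pB => //; [exact: submoduleZ|rewrite pZ// fb].
    move=> x; suff -> : y * eval u x - (y *: f - g) x = g x by apply: gs.
    by rewrite fu -[(_ - _) x]/(y * eval u x - g x) opprB addrC subrK.
  (* As [p] is linear only on [F], membership in [F] is carried along with the claim. *)
  pose Z := [set g | F g /\ imul (ideal_of s) [set: B] (p g)].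
  have sZ : submodule Z.
    apply: submoduleI => [|a g1 g2 [Fg1 g1s] [Fg2 g2s]].
      split; first exact: submodule0.
      by rewrite p0; apply: submodule0 (submodule_gen _).
    split; first exact: submoduleL.
    by rewrite plin//; apply: submoduleL (submodule_gen _) _ _.
  have [Fr rs] : Z (\sum_(l < size s) s`_l *: (delta (Soln t l) : _ -> R^o)).
    apply: submodule_sum => // l.
    have Fl : F (delta (Soln t l)).
      by apply: combinations_delta; right; exists t, l.
    split; first exact: submoduleZ.
    rewrite pZ//; apply: mem_imul => //; apply: mem_gen_submod.
    exact/mem_nth.
  rewrite -fb; suff -> : p f = p (\sum_(l < size s)
    s`_l *: (delta (Soln t l) : _ -> R^o)) by [].
  apply/eqP; rewrite -subr_eq0 addrC -scaleN1r -plin//; apply/eqP/pK.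
    exact: submoduleL.
  (* The difference is the relator of [t] itself, hence the vector 1. *)
  rewrite scaleN1r addrC; apply: mem_gen_submod; exists t => //; exists 1.
  apply/funext => x; rewrite fu /relator.
  rewrite -[(_ - _) x]/(eval u x - (\sum_(l < size s) _) x) fct_sumE.
  by rewrite -[RHS]/(_ * 1) mulr1.
(* If m B = B, the image of 1 is represented with coefficients in m. The resulting relation has all
   coordinates off [Root] in m, so control puts 1 - [f Root] in m, and hence 1. *)
have [f [Ff fr fm]] : exists f, [/\ F f, p f = p (delta (@Root R)) &
    forall x, m (f x)] by apply: lift => //; rewrite mB.
apply: m1; have -> : (1 : R) = (delta (@Root R) - f) (@Root R) + f (@Root R).
  rewrite -[RHS]/(delta (@Root R) (@Root R) - f (@Root R) + f (@Root R)).
  by rewrite subrK delta_eq.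
apply: (submoduleD sm) (fm _).
apply: (controlled_root sm Sctrl); first exact: pB.
move=> x xr; rewrite -[(_ - _) x]/(delta (@Root R) x - f x) delta_neq; last exact/nesym.
by rewrite sub0r; apply: (submoduleN sm).
Qed.

End ControlledModifications.

Theorem theorem3p16 (R : idomainType) (m : set R)
  (Rlocal : local_ring m)
  (Rcomplete : adically_complete m)
  (nat_cl : forall M : lmodType R, set M -> set M)
  (ax1 : forall (M : lmodType R) (N : set M),
     fg_module M -> submodule N ->
     submodule (nat_cl M N) /\ N `<=` nat_cl M N)
  (ax2 : forall (M : lmodType R) (N : set M),
     fg_module M -> submodule N ->
     nat_cl M (nat_cl M N) = nat_cl M N)
  (ax3 : forall (W : lmodType R) (N M : set W),
     fg_module W -> submodule N -> submodule M -> N `<=` M ->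
     nat_cl W N `<=` nat_cl W M)
  (ax4 : forall (M W : lmodType R) (N : set M) (f : {linear M -> W}),
     fg_module M -> fg_module W -> submodule N ->
     f @` nat_cl M N `<=` nat_cl W (f @` N))
  (ax5 : forall (M : lmodType R) (N : set M) (submodN : submodule N),
     fg_module M -> nat_cl M N = N ->
     nat_cl (quotm submodN) [set 0] = [set 0])
  (ax6 : nat_cl R^o m = m /\ nat_cl R^o [set 0] = [set 0])
  (ax7 : forall (s : seq R) (x : R), partial_sop m (rcons s x) ->
     forall (M : lmodType R) (f : {linear M -> quotm (submodule_ideal_of s)})
            (v : M),
     fg_module M -> range f = setT ->
     f v = quotm_pi (submodule_ideal_of s) x ->
     nat_cl M (gen_submod [set v]) `&` f @^-1` [set 0]
       `<=` nat_cl M (imul (ideal_of s) [set v])) :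
  exists B : lmodType R, balanced_big_CM m B.

Proof.
have [_ [[m0 m1 mlin] _] _] := Rlocal.
apply: (@controlled_bigCM R m nat_cl) => //; first by case: ax6.
by move=> /mem_set; apply/negP.
Qed.
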